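(* Let $W_{\boldsymbol\lambda}\in \boldsymbol B(\ell^2)$ and $W_{\boldsymbol\omega}\in \boldsymbol B(\ell^2)$ be unilateral weighted shifts. Then the following conditions are equivalent: (i) there exist operators $X,Y \in \boldsymbol B(\ell^2)$ with dense range such that $XW_{\boldsymbol\lambda} = W_{\boldsymbol\omega}X$ and $Y W_{\boldsymbol\omega}=W_{\boldsymbol\lambda} Y$, (ii) $W_{\boldsymbol\lambda}$ and $W_{\boldsymbol\omega}$ are quasi-similar, (iii) $W_{\boldsymbol\lambda}$ and $W_{\boldsymbol\omega}$ are similar, (iv) $0 < \inf_{n\in \mathbb Z_+} \frac{\hat\omega_n}{\hat\lambda_n}$ and $\sup_{n\in \mathbb Z_+}\frac{\hat\omega_n}{\hat\lambda_n} < \infty$.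
   Context: $\mathbb Z_+=\{0,1,2,\dots\}$; $\{e_n\}_{n=0}^\infty$ is the standard orthonormal basis of the complex Hilbert space $\ell^2=\ell^2(\mathbb Z_+)$; $\boldsymbol B(\ell^2)$ is the set of bounded linear operators on $\ell^2$. For a bounded sequence $\boldsymbol\lambda=\{\lambda_n\}_{n=0}^\infty\subseteq(0,\infty)$, the unilateral weighted shift $W_{\boldsymbol\lambda}\in\boldsymbol B(\ell^2)$ is the operator with $W_{\boldsymbol\lambda}e_n=\lambda_n e_{n+1}$, $n\in\mathbb Z_+$. Put $\hat\lambda_0=1$ and $\hat\lambda_n=\lambda_0^2\cdots\lambda_{n-1}^2$ for $n\geqslant1$; $\hat\omega_n$ is defined analogously from $\boldsymbol\omega=\{\omega_n\}_{n=0}^\infty$. An operator is quasi-invertible if it is injective and has dense range; $A\in\boldsymbol B(\mathcal H)$ is a quasi-affine transform of $B\in\boldsymbol B(\mathcal K)$ if there is a quasi-invertible bounded linear $X\colon\mathcal H\to\mathcal K$ with $XA=BX$. $A$ and $B$ are quasi-similar if each is a quasi-affine transform of the other; they are similar if $XA=BX$ for some bijective bounded linear $X\colon\mathcal H\to\mathcal K$. *)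

(* Defs.v *)
From HB Require Import structures.
From mathcomp Require Import all_boot all_order all_algebra complex.
From mathcomp Require Import all_classical all_reals all_analysis.
From mathcomp Require Import ring lra.
Import Order.TTheory GRing.Theory Num.Theory.
Import numFieldNormedType.Exports.
Import ComplexField.Normc.

Set Implicit Arguments.
Unset Strict Implicit.
Unset Printing Implicit Defensive.

Local Open Scope classical_set_scope.
Local Open Scope ring_scope.
Local Open Scope complex_scope.

Section SquareSummable.
Context {R : realType}.
Implicit Types u v : nat -> R[i]^o.

(* `normc z : R` is the modulus of z; the norm `|z| lives in R[i]. *)
Definition sqsum_upto u (N : nat) : R := \sum_(0 <= n < N) normc (u n) ^+ 2.

Definition square_summable u : Prop := cvgn (sqsum_upto u).

Definition sqsum u : R := limn (sqsum_upto u).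

Definition square_summable_pred : {pred nat -> R[i]^o} :=
  mem [set u | square_summable u].

Lemma sqsum_upto_ge0 u N : 0 <= sqsum_upto u N.
Proof. by apply: sumr_ge0 => n _; apply: sqr_ge0. Qed.

Lemma sqsum_upto_nd u : nondecreasing_seq (sqsum_upto u).
Proof.
by apply/nondecreasing_seqP => n; rewrite /sqsum_upto big_nat_recr//= lerDl sqr_ge0.
Qed.

Lemma sqsum_upto_le u N : square_summable u -> sqsum_upto u N <= sqsum u.
Proof. by move=> su; apply: nondecreasing_cvgn_le => //; apply: sqsum_upto_nd. Qed.

Lemma sqsum_ge0 u : square_summable u -> 0 <= sqsum u.
Proof. by move=> /(sqsum_upto_le 0); apply: le_trans; exact: sqsum_upto_ge0. Qed.

Lemma square_summable_bound u (M : R) :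
  (forall N, sqsum_upto u N <= M) -> square_summable u /\ sqsum u <= M.
Proof.
move=> uM; have cu : square_summable u.
  by apply: nondecreasing_is_cvgn; [exact: sqsum_upto_nd|exists M => _ [N _ <-]].
by split=> //; apply: limr_le => //; apply: nearW.
Qed.

Lemma minkowski2 (a b c p q s : R) : 0 <= a -> 0 <= b -> 0 <= c ->
  0 <= p -> 0 <= q -> 0 <= s -> c <= a + b -> s <= p + q ->
  Num.sqrt (s ^+ 2 + c ^+ 2)
    <= Num.sqrt (p ^+ 2 + a ^+ 2) + Num.sqrt (q ^+ 2 + b ^+ 2).
Proof.
move=> a0 b0 c0 p0 q0 s0 cab spq.
set x := Num.sqrt (p ^+ 2 + _); set y := Num.sqrt (q ^+ 2 + _).
have x0 : 0 <= x by exact: sqrtr_ge0.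
have y0 : 0 <= y by exact: sqrtr_ge0.
have xE : x ^+ 2 = p ^+ 2 + a ^+ 2 by rewrite sqr_sqrtr// addr_ge0 ?sqr_ge0.
have yE : y ^+ 2 = q ^+ 2 + b ^+ 2 by rewrite sqr_sqrtr// addr_ge0 ?sqr_ge0.
have xy : p * q + a * b <= x * y.
  rewrite -(@ler_pXn2r _ 2)// ?nnegrE ?mulr_ge0 ?addr_ge0 ?mulr_ge0//.
  rewrite [leRHS]exprMn xE yE -subr_ge0.
  rewrite (_ : _ - _ = (p * b - q * a) ^+ 2) ?sqr_ge0//; ring.
rewrite -[leRHS]ger0_norm ?addr_ge0// -sqrtr_sqr ler_wsqrtr//.
have : s ^+ 2 <= (p + q) ^+ 2 by rewrite ler_pXn2r ?nnegrE ?addr_ge0.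
have : c ^+ 2 <= (a + b) ^+ 2 by rewrite ler_pXn2r ?nnegrE ?addr_ge0.
rewrite !sqrrD xE yE => h1 h2; lra.
Qed.

Lemma normc_ge0' (z : R[i]) : 0 <= normc z.
Proof. by case: z => a b /=; exact: sqrtr_ge0. Qed.

Lemma sqsum_upto_minkowski u v N : Num.sqrt (sqsum_upto (u + v) N) <=
  Num.sqrt (sqsum_upto u N) + Num.sqrt (sqsum_upto v N).
Proof.
elim: N => [|N IH]; first by rewrite /sqsum_upto !big_geq// sqrtr0 addr0.
have S w : sqsum_upto w N.+1 =
    Num.sqrt (sqsum_upto w N) ^+ 2 + normc (w N) ^+ 2.
  by rewrite /sqsum_upto big_nat_recr//= sqr_sqrtr// sqsum_upto_ge0.
rewrite !S; apply: minkowski2 => //; rewrite ?normc_ge0' ?sqrtr_ge0//.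
exact: le_normcD.
Qed.

Lemma sqsum_uptoZ (c : R[i]) u N :
  sqsum_upto (c *: u) N = normc c ^+ 2 * sqsum_upto u N.
Proof.
by rewrite /sqsum_upto mulr_sumr; apply: eq_bigr => n _; rewrite -exprMn -normcM.
Qed.

Lemma square_summableD u v : square_summable u -> square_summable v ->
  square_summable (u + v) /\
  Num.sqrt (sqsum (u + v)) <= Num.sqrt (sqsum u) + Num.sqrt (sqsum v).
Proof.
move=> su sv; set M := Num.sqrt (sqsum u) + _.
have M0 : 0 <= M by rewrite addr_ge0 ?sqrtr_ge0.
have [] := @square_summable_bound (u + v) (M ^+ 2).
  move=> N; rewrite -[leLHS]sqr_sqrtr ?sqsum_upto_ge0// ler_pXn2r ?nnegrE ?sqrtr_ge0//.
  apply: le_trans (sqsum_upto_minkowski u v N) _.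
  by apply: lerD; apply: ler_wsqrtr; exact: sqsum_upto_le.
by move=> ? h; split=> //; rewrite -[leRHS]ger0_norm// -sqrtr_sqr ler_wsqrtr.
Qed.

Lemma square_summableZ c u : square_summable u ->
  square_summable (c *: u) /\ sqsum (c *: u) = normc c ^+ 2 * sqsum u.
Proof.
move=> su; rewrite /square_summable /sqsum.
have -> : sqsum_upto (c *: u) = (fun N => normc c ^+ 2 *: (sqsum_upto u N : R^o)).
  by apply/funext => N; rewrite sqsum_uptoZ.
split; first exact: is_cvgZr.
exact: limZr.
Qed.

Lemma square_summable0 : square_summable 0.
Proof.
apply: (proj1 (@square_summable_bound 0 0 _)) => N.
by rewrite /sqsum_upto big1// => n _; rewrite normc0 expr0n.
Qed.

Lemma sqsum_eq0 u : square_summable u -> sqsum u = 0 -> u = 0.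
Proof.
move=> su u0; apply/funext => n; apply: eq0_normc; apply/eqP.
rewrite -sqrf_eq0 eq_le sqr_ge0 andbT.
have := sqsum_upto_le n.+1 su; rewrite u0 /sqsum_upto big_nat_recr//=.
by apply: le_trans; rewrite lerDr; exact: sqsum_upto_ge0.
Qed.

Lemma square_summable_submod : submod_closed square_summable_pred.
Proof.
split; first by rewrite !inE; exact: square_summable0.
move=> c u v; rewrite !inE => su sv.
by have [+ _] := square_summableD (proj1 (square_summableZ c su)) sv.
Qed.

HB.instance Definition _ :=
  GRing.isSubmodClosed.Build _ _ square_summable_pred square_summable_submod.

End SquareSummable.

Section Ell2.
Variable R : realType.

Record ell2 : Type := Ell2 {
  ell2_val :> nat -> R[i]^o;
  _ : ell2_val \in square_summable_pred }.

HB.instance Definition _ := [isSub for ell2_val].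
HB.instance Definition _ := [Choice of ell2 by <:].
HB.instance Definition _ := [SubChoice_isSubLmodule of ell2 by <:].

Lemma ell2_summable (x : ell2) : square_summable x.
Proof. by case: x => u /=; rewrite inE. Qed.
Arguments ell2_summable : clear implicits.

(* The norm is R[i]-valued, as required for a normed module over R[i]. *)
Definition ell2_norm (x : ell2) : R[i] := (Num.sqrt (sqsum x))%:C.

Lemma ell2_ler_normD x y : ell2_norm (x + y) <= ell2_norm x + ell2_norm y.
Proof.
rewrite /ell2_norm -rmorphD/= lecR.
exact: (proj2 (square_summableD (ell2_summable x) (ell2_summable y))).
Qed.

Lemma ell2_normrZ (c : R[i]) x : ell2_norm (c *: x) = `|c| * ell2_norm x.
Proof.
rewrite /ell2_norm (_ : `|c| = (normc c)%:C)// -rmorphM/=.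
rewrite (proj2 (square_summableZ c (ell2_summable x))).
by rewrite sqrtrM ?sqr_ge0// sqrtr_sqr ger0_norm// normc_ge0'.
Qed.

Lemma ell2_normr0_eq0 x : ell2_norm x = 0 -> x = 0.
Proof.
move=> /complexI /eqP; rewrite sqrtr_eq0 => h; apply: val_inj.
have sx := ell2_summable x.
by apply: sqsum_eq0 => //; apply: le_anti; rewrite h sqsum_ge0.
Qed.

HB.instance Definition _ := Lmodule_isNormed.Build R[i] ell2
  ell2_ler_normD ell2_normrZ ell2_normr0_eq0.

Lemma ell2_basis_subproof (n : nat) :
  (fun k => (k == n)%:R : R[i]^o) \in square_summable_pred.
Proof.
rewrite inE; apply: (proj1 (@square_summable_bound _ _ 1 _)) => N.
rewrite /sqsum_upto.
have [nN|Nn] := ltnP n N; last first.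
  rewrite big_nat big1 ?ler01// => k /andP[_ kN].
  by rewrite (ltn_eqF (leq_trans kN Nn)) normc0 expr0n.
rewrite (bigD1_seq n) ?mem_index_iota ?iota_uniq//= eqxx normc1 expr1n.
by rewrite big1 ?addr0// => k /negbTE ->; rewrite normc0 expr0n.
Qed.

Definition ell2_basis (n : nat) : ell2 := Ell2 (ell2_basis_subproof n).

End Ell2.

Section Operators.
Context {K : numFieldType}.
Implicit Types V W : normedModType K.

(* Over K = R[i] the order forces M to be a nonnegative real as soon as some
   x is nonzero. *)
Definition bounded_op V W (X : {linear V -> W}) : Prop :=
  exists M : K, forall x, `|X x| <= M * `|x|.

Definition quasi_invertible V W (X : {linear V -> W}) : Prop :=
  injective X /\ dense (range X).

Definition quasi_affine_transform V W
    (A : {linear V -> V}) (B : {linear W -> W}) : Prop :=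
  exists X : {linear V -> W},
    [/\ bounded_op X, quasi_invertible X & X \o A = B \o X].

Definition quasi_similar V W
    (A : {linear V -> V}) (B : {linear W -> W}) : Prop :=
  quasi_affine_transform A B /\ quasi_affine_transform B A.

Definition similar_op V W
    (A : {linear V -> V}) (B : {linear W -> W}) : Prop :=
  exists X : {linear V -> W},
    [/\ bounded_op X, bijective X & X \o A = B \o X].

End Operators.

Section WeightedShift.
Variable R : realType.
Implicit Types l : nat -> R.

(* Characterizes W on the orthonormal basis; see weighted_shift_exists for
   existence when l is bounded. *)
Definition weighted_shift l (W : {linear ell2 R -> ell2 R}) : Prop :=
  bounded_op W /\
  forall n, W (ell2_basis R n) = (l n)%:C *: ell2_basis R n.+1.

Definition weight_hat l (n : nat) : R := \prod_(i < n) l i ^+ 2.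

Definition shift_fun l (u : nat -> R[i]^o) : nat -> R[i]^o :=
  fun n => if n is m.+1 then (l m)%:C * u m else 0.

Lemma shift_fun_bound l (M : R) (x : ell2 R) : (forall n, `|l n| <= M) ->
  square_summable (shift_fun l x) /\
  sqsum (shift_fun l x) <= M ^+ 2 * sqsum x.
Proof.
move=> lM; apply: square_summable_bound => N.
apply: (@le_trans _ _ (M ^+ 2 * sqsum_upto x N)); last first.
  by rewrite ler_wpM2l ?sqr_ge0//; apply: sqsum_upto_le; exact: ell2_summable.
case: N => [|N]; first by rewrite /sqsum_upto !big_geq// mulr0.
apply: (@le_trans _ _ (M ^+ 2 * sqsum_upto x N)); last first.
  by rewrite ler_wpM2l ?sqr_ge0//; exact: sqsum_upto_nd.
rewrite /sqsum_upto big_nat_recl//= [X in X ^+ 2 + _](_ : _ = 0); last exact: normc0.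
rewrite expr0n add0r mulr_sumr.
apply: ler_sum => n _; rewrite normcM exprMn ler_wpM2r ?sqr_ge0//.
rewrite /= expr0n addr0 sqrtr_sqr ler_pXn2r// ?nnegrE//.
exact: le_trans (lM 0).
Qed.

Lemma weighted_shift_exists l : bounded_fun l ->
  exists W : {linear ell2 R -> ell2 R}, weighted_shift l W.
Proof.
move=> /pinfty_ex_gt0[M /ltW M0 lM']; have lM n : `|l n| <= M by exact: lM'.
have sP (x : ell2 R) : shift_fun l x \in square_summable_pred.
  by rewrite inE; exact: (proj1 (shift_fun_bound x lM)).
pose W (x : ell2 R) : ell2 R := Ell2 (sP x).
have linW : linear W.
  move=> c x y; apply: val_inj; apply/funext => -[|n] /=.
    by change (0 = c * 0 + 0 :> R[i]); rewrite mulr0 addr0.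
  change ((l n)%:C * (c * x n + y n) = c * ((l n)%:C * x n) + (l n)%:C * y n :> R[i]).
  by ring.
pose WL : {linear ell2 R -> ell2 R} :=
  HB.pack W (GRing.isLinear.Build _ _ _ _ _ linW).
exists WL; split.
  exists M%:C => x; change (ell2_norm (W x) <= M%:C * ell2_norm x).
  rewrite /ell2_norm -rmorphM/= lecR.
  rewrite -{1}(ger0_norm M0) -sqrtr_sqr -sqrtrM ?sqr_ge0//.
  by apply: ler_wsqrtr; exact: (proj2 (shift_fun_bound x lM)).
move=> n; apply: val_inj; apply/funext => -[|k] /=.
  by change (0 = (l n)%:C * 0 :> R[i]); rewrite mulr0.
change ((l k)%:C * (k == n)%:R = (l n)%:C * (k.+1 == n.+1)%:R :> R[i]).
by rewrite eqSS; have [->//|_] := eqVneq k n; rewrite !mulr0.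
Qed.

End WeightedShift.

(* Main.v *)
Require Import Defs.
From HB Require Import structures.
From mathcomp Require Import all_boot all_order all_algebra complex.
From mathcomp Require Import all_classical all_reals all_analysis.
Import Order.TTheory GRing.Theory Num.Theory.
Import numFieldNormedType.Exports.
From mathcomp Require Import ring lra.
Import ComplexField.Normc.

(** Let X be bounded with X W_l = W_w X.  In the standard basis its matrix is
    lower triangular with diagonal entries X_nn = (Omega_n / L_n) X_00, where
    L_n and Omega_n are the products of the first n weights of the two shifts
    (weight_prod), so that the quotient of the weight_hat sequences is
    (Omega_n / L_n)^2.  A bounded operator has bounded matrix entries, and a
    dense range forces X_00 != 0 since all other entries of row 0 vanish.  So
    one dense-range intertwiner bounds the quotient above, and one in the other
    direction bounds it below (intertwiner_dominated).  Conversely, when the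
    quotient is bounded above and below, the diagonal operator with entries
    Omega_n / L_n is a similarity (dominated_similar).

    Similarity only provides a bijective bounded X, and the lower bound for the
    quotient must come out of it.  Instead of the boundedness of the inverse,
    the triangular form gives it (surjective_intertwiner_dominated): solving
    X x = y by forward substitution, with the signs of y adjusted along the way
    (triangular_solution), shows that 1 / |X_nn| multiplies l^2 into l^2, and
    such a multiplier is bounded (ell2_multiplier_bounded).  *)

Set Implicit Arguments.
Unset Strict Implicit.
Unset Printing Implicit Defensive.

Local Open Scope classical_set_scope.
Local Open Scope ring_scope.
Local Open Scope complex_scope.

(** * Bounded operators *)

Section BoundedOperators.
Context {K : numFieldType}.
Implicit Types U V W : normedModType K.

(** A negative or non-real bound can only occur when every `|x| is zero, so
    replacing a bound by its modulus is harmless. *)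
Lemma bounded_op_ge0 V W (X : {linear V -> W}) : bounded_op X ->
  exists2 M : K, 0 <= M & forall x, `|X x| <= M * `|x|.
Proof.
move=> [M XM]; exists `|M| => // x.
have /ger0_norm E : 0 <= M * `|x| by apply: le_trans (XM x).
by rewrite -[`|x|]normr_id -normrM E.
Qed.

Lemma bounded_op_comp U V W (X : {linear V -> W}) (Y : {linear U -> V}) :
  bounded_op X -> bounded_op Y -> bounded_op (X \o Y : {linear U -> W}).
Proof.
move=> /bounded_op_ge0[M M0 XM] [N YN]; exists (M * N) => x /=.
by rewrite -mulrA (le_trans (XM _))// ler_wpM2l.
Qed.

Lemma bounded_opB V W (X Y : {linear V -> W}) :
  bounded_op X -> bounded_op Y -> bounded_op (X \- Y : {linear V -> W}).
Proof.
move=> [M XM] [N YN]; exists (M + N) => x /=.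
by rewrite mulrDl (le_trans (ler_normB _ _))// lerD.
Qed.

Lemma bounded_opZ V W (c : K) (X : {linear V -> W}) :
  bounded_op X -> bounded_op (c \*: X : {linear V -> W}).
Proof.
move=> [M XM]; exists (`|c| * M) => x /=.
by rewrite normrZ -mulrA ler_wpM2l.
Qed.
End BoundedOperators.

(** * Coordinates in l^2 *)

Lemma normc_real {R : rcfType} (r : R) : 0 <= r -> normc r%:C = r.
Proof. by move=> r0; rewrite /= expr0n addr0 sqrtr_sqr ger0_norm. Qed.

Lemma normc_gt0 {R : realType} (z : R[i]) : z != 0 -> 0 < normc z.
Proof.
move=> z0; rewrite lt_neqAle normc_ge0' andbT eq_sym.
by apply: contraNneq z0 => /eq0_normc ->.
Qed.

Section Ell2Coordinates.
Variable R : realType.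
Local Notation ell2 := (ell2 R).
Local Notation e := (ell2_basis R).
Implicit Types x y : ell2.

Lemma ell2_sqsumE x : `|x| = (Num.sqrt (sqsum x))%:C.
Proof. by []. Qed.

Lemma ell2_addE x y n : (x + y) n = x n + y n. Proof. by []. Qed.
Lemma ell2_oppE x n : (- x) n = - x n. Proof. by []. Qed.
Lemma ell2_scaleE (c : R[i]) x n : (c *: x) n = c * x n. Proof. by []. Qed.

Lemma ell2_ext x y : x =1 y -> x = y.
Proof. by move=> xy; apply/val_inj/funext. Qed.

Lemma normc_coord_le x n : normc (x n) <= Num.sqrt (sqsum x).
Proof.
rewrite -[leLHS]ger0_norm ?normc_ge0'// -sqrtr_sqr ler_wsqrtr//.
apply: (@le_trans _ _ (sqsum_upto x n.+1)); last first.
  by apply: sqsum_upto_le; exact: ell2_summable.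
by rewrite /sqsum_upto big_nat_recr//= lerDr sqsum_upto_ge0.
Qed.

Definition ell2_coord n : ell2 -> R[i]^o := fun x => x n.

Lemma ell2_coord_linear n : linear (ell2_coord n).
Proof. by []. Qed.

HB.instance Definition _ n :=
  GRing.isLinear.Build _ _ _ _ (ell2_coord n) (ell2_coord_linear n).

Lemma bounded_ell2_coord n : bounded_op (ell2_coord n : {linear ell2 -> R[i]^o}).
Proof.
exists 1 => x; rewrite mul1r ell2_sqsumE.
rewrite (_ : `|_| = (normc (x n))%:C)// lecR.
exact: normc_coord_le.
Qed.

Lemma norm_ell2_basis n : `|e n| <= 1.
Proof.
rewrite ell2_sqsumE -[1]/(1%:C) lecR -sqrtr1 ler_wsqrtr//.
apply: (proj2 (@square_summable_bound _ _ 1 _)) => N.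
rewrite /sqsum_upto.
have [nN|Nn] := ltnP n N; last first.
  rewrite big_nat big1 ?ler01// => k /andP[_ kN] /=.
  by rewrite (ltn_eqF (leq_trans kN Nn)) normc0 expr0n.
rewrite (bigD1_seq n) ?mem_index_iota ?iota_uniq//= eqxx normc1 expr1n.
by rewrite big1 ?addr0// => k /negbTE ->; rewrite normc0 expr0n.
Qed.

Lemma ell2_sumE (I : Type) (r : seq I) (F : I -> ell2) n :
  (\sum_(i <- r) F i) n = \sum_(i <- r) F i n.
Proof. exact: (raddf_sum (ell2_coord n)). Qed.

Lemma ell2_truncE x N k :
  (\sum_(0 <= n < N) x n *: e n) k = (if (k < N)%N then x k else 0).
Proof.
have E i : (x i *: e i) k = x i * (k == i)%:R by [].
rewrite ell2_sumE (eq_bigr _ (fun i _ => E i)); case: ifP => kN.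
  rewrite (bigD1_seq k) ?mem_index_iota ?iota_uniq//= eqxx mulr1.
  by rewrite big1 ?addr0// => i /negbTE; rewrite eq_sym => ->; rewrite mulr0.
rewrite big_nat big1// => i /andP[_ iN].
by rewrite gtn_eqF ?mulr0// (leq_trans iN)// leqNgt kN.
Qed.

(** The vector on the left vanishes below N and agrees with x from N on. *)
Lemma sqsum_tail x N :
  sqsum (x - \sum_(0 <= n < N) x n *: e n) <= sqsum x - sqsum_upto x N.
Proof.
apply: (proj2 (square_summable_bound _)) => K.
apply: (@le_trans _ _ (sqsum_upto x (maxn N K) - sqsum_upto x N)); last first.
  by rewrite lerB// sqsum_upto_le//; exact: ell2_summable.
set u := (_ - _ : ell2).
have uE k : u k = if (k < N)%N then 0 else x k.
  by rewrite ell2_addE ell2_oppE ell2_truncE; case: ifP; rewrite ?subrr ?subr0.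
move: u uE => u uE.
apply: (@le_trans _ _ (sqsum_upto u (maxn N K))).
  by apply: sqsum_upto_nd; exact: leq_maxr.
rewrite /sqsum_upto (big_cat_nat (n := N)) ?leq_maxl//.
rewrite [X in _ <= X - _](big_cat_nat (n := N)) ?leq_maxl//.
rewrite [leRHS]addrAC subrr add0r big_nat big1; last first.
  by move=> k /andP[_ kN]; rewrite uE kN normc0 expr0n.
rewrite /= add0r; apply: ler_sum_nat => k /andP[Nk _].
by rewrite uE ltnNge Nk.
Qed.

(** The truncations of x converge to x, so a bounded operator that kills the
    basis vectors from index m on only sees the first m coordinates.  If f x
    differed from the sum, boundedness would keep all tails of x at least a
    fixed a > 0 in norm, so every partial sum of squares would stay below
    sqsum x - a ^+ 2, and then so would sqsum x itself. *)
Lemma bounded_op_basis_sum (V : normedModType R[i]) (f : {linear ell2 -> V})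
    m : bounded_op f -> (forall n, (m <= n)%N -> f (e n) = 0) ->
  forall x, f x = \sum_(0 <= n < m) x n *: f (e n).
Proof.
move=> /bounded_op_ge0[M M0 fM] f0 x; set s := \sum_(_ <= _ < _) _.
apply/eqP; rewrite -subr_eq0; apply/negP => /negP fx0.
have fle N : (m <= N)%N ->
    `|f x - s| <= M * (Num.sqrt (sqsum x - sqsum_upto x N))%:C.
  move=> mN; have -> : f x - s = f (x - \sum_(0 <= n < N) x n *: e n).
    rewrite linearB; congr (_ - _); rewrite linear_sum.
    rewrite [RHS](big_cat_nat (n := m))//= [X in _ = _ + X]big_nat.
    rewrite [X in _ = _ + X]big1 ?addr0 => [|n /andP[mn _]].
      by apply: eq_bigr => n _; rewrite linearZ.
    by rewrite linearZ /= f0// scaler0.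
  apply: le_trans (fM _) _; rewrite ler_wpM2l// ell2_sqsumE lecR ler_wsqrtr//.
  exact: sqsum_tail.
have Mgt0 : 0 < M.
  rewrite lt_neqAle M0 andbT eq_sym; apply: contraNneq fx0 => M00.
  by have := fle m (leqnn m); rewrite M00 mul0r normr_le0.
(* Norms live in R[i]; a is the quotient `|f x - s| / M as an element of R. *)
have [a a0 aE] : exists2 a : R, 0 < a & `|f x - s| / M = a%:C.
  have r0 : 0 < `|f x - s| / M by rewrite divr_gt0 ?normr_gt0.
  have rE := RRe_real (ger0_real (ltW r0)).
  by exists (complex.Re (`|f x - s| / M)); rewrite ?rE// -ltcR rE.
have ale N : (m <= N)%N -> a ^+ 2 <= sqsum x - sqsum_upto x N.
  move=> mN; have d0 : 0 <= sqsum x - sqsum_upto x N.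
    by rewrite subr_ge0 sqsum_upto_le//; exact: ell2_summable.
  rewrite -[leRHS]sqr_sqrtr// ler_pXn2r ?nnegrE ?sqrtr_ge0 ?(ltW a0)//.
  by rewrite -lecR -aE ler_pdivrMr// mulrC fle.
have upto_le N : sqsum_upto x N <= sqsum x - a ^+ 2.
  apply: (@le_trans _ _ (sqsum_upto x (maxn m N))).
    by apply: sqsum_upto_nd; exact: leq_maxr.
  by rewrite lerBrDl -lerBrDr ale// leq_maxl.
have [_] := square_summable_bound upto_le.
by rewrite lerBrDl gerDr leNgt exprn_gt0.
Qed.

Lemma bounded_op_basis_eq (V : normedModType R[i]) (f g : {linear ell2 -> V}) :
  bounded_op f -> bounded_op g -> (forall n, f (e n) = g (e n)) -> f =1 g.
Proof.
move=> fM gM fg x; apply/eqP; rewrite -subr_eq0; apply/eqP.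
have := bounded_op_basis_sum (m := 0) (bounded_opB fM gM) _ x.
by rewrite big_geq//; apply => n _ /=; rewrite fg subrr.
Qed.

End Ell2Coordinates.
Arguments bounded_ell2_coord {R} n.
Arguments ell2_coord {R} n.

(** * The matrix of an intertwiner of two weighted shifts *)

Section Intertwiners.
Variable R : realType.
Local Notation ell2 := (ell2 R).
Local Notation e := (ell2_basis R).
Implicit Types (l w : nat -> R) (x : ell2) (W X : {linear ell2 -> ell2}).

Lemma weighted_shift0 l W x : weighted_shift l W -> W x 0%N = 0.
Proof.
move=> [WM We].
have WM0 := bounded_op_comp (bounded_ell2_coord 0%N) WM.
have := bounded_op_basis_sum (m := 0) WM0 _ x.
rewrite big_geq//; apply => n _ /=.
by rewrite /ell2_coord We ell2_scaleE /= mulr0.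
Qed.

Lemma weighted_shiftS l W x n : weighted_shift l W ->
  W x n.+1 = (l n)%:C * x n.
Proof.
move=> [WM We].
apply: (bounded_op_basis_eq (bounded_op_comp (bounded_ell2_coord n.+1) WM)
          (bounded_opZ (l n)%:C (bounded_ell2_coord n))) => k /=.
rewrite /ell2_coord We ell2_scaleE.
change ((l k)%:C * (n.+1 == k.+1)%:R = (l n)%:C * (n == k)%:R :> R[i]).
by rewrite eqSS; case: eqVneq => [->//|_]; rewrite !mulr0.
Qed.

(** The square root of weight_hat; the n-th power of the shift with weights l
    maps e_0 to weight_prod l n times e_n. *)
Definition weight_prod l n : R := \prod_(i < n) l i.

Lemma weight_hatE l n : weight_hat l n = weight_prod l n ^+ 2.
Proof. by rewrite /weight_hat prodrXl. Qed.

Lemma weight_prodS l n : weight_prod l n.+1 = weight_prod l n * l n.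
Proof. exact: big_ord_recr. Qed.

Lemma weight_prod_gt0 l n : (forall n, 0 < l n) -> 0 < weight_prod l n.
Proof. by move=> l0; apply: prodr_gt0. Qed.

Definition weight_dominated l w : Prop :=
  exists C : R, forall n, weight_hat w n <= C * weight_hat l n.

Section Matrix.
Variables (l w : nat -> R) (Wl Ww X : {linear ell2 -> ell2}).
Hypotheses (l_gt0 : forall n, 0 < l n) (w_gt0 : forall n, 0 < w n).
Hypotheses (Wl_shift : weighted_shift l Wl) (Ww_shift : weighted_shift w Ww).
Hypotheses (X_bounded : bounded_op X) (XWl : X \o Wl = Ww \o X).

(** Each column of the matrix of X determines the next one, because
    X W_l e_n = W_w X e_n; the next three lemmas read off the matrix: it is
    lower triangular, its diagonal is a multiple of the ratio of the weight
    products, and each coordinate of X x is a finite sum. *)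
Lemma intertwiner_basisS n : (l n)%:C *: X (e n.+1) = Ww (X (e n)).
Proof.
by rewrite -linearZ/= -(proj2 Wl_shift); exact: (congr1 (@^~ (e n)) XWl).
Qed.

Let lC_neq0 n : (l n)%:C != 0 :> R[i].
Proof. by rewrite fmorph_eq0 gt_eqF. Qed.

Lemma intertwiner_lower m n : (m < n)%N -> X (e n) m = 0.
Proof.
elim: n m => // n IH m mn; apply: (mulfI (lC_neq0 n)); rewrite mulr0 -ell2_scaleE.
rewrite intertwiner_basisS; case: m mn => [|m] mn; 
  first exact: (weighted_shift0 _ Ww_shift).
by rewrite (weighted_shiftS _ _ Ww_shift) IH ?mulr0.
Qed.

Lemma intertwiner_diag n : (weight_prod l n)%:C * X (e n) n =
  (weight_prod w n)%:C * X (e 0) 0%N.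
Proof.
elim: n => [|n IH]; first by rewrite /weight_prod !big_ord0.
rewrite !weight_prodS !rmorphM/= -mulrA -ell2_scaleE intertwiner_basisS.
by rewrite (weighted_shiftS _ _ Ww_shift) mulrCA IH mulrCA mulrA.
Qed.

Lemma intertwiner_coord x m : X x m = \sum_(0 <= k < m.+1) x k * X (e k) m.
Proof.
apply: (bounded_op_basis_sum (bounded_op_comp (bounded_ell2_coord m) X_bounded)).
by move=> n mn /=; exact: intertwiner_lower.
Qed.

(** The 0th coordinate of X x is x_0 times the corner entry; with a zero corner
    the whole range would lie in a closed hyperplane orthogonal to e_0. *)
Lemma intertwiner_dense_corner : dense (range X) -> X (e 0) 0%N != 0.
Proof.
move=> Xd; apply/eqP => X00.
(* Every vector of that hyperplane is at distance at least 1 from e_0. *)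
have [||y [e0y [x _ xy]]] := Xd (ball (e 0) 1).
- by exists (e 0); exact: ballxx.
- exact: ball_open.
have : normc ((e 0 - X x) 0%N) <= Num.sqrt (sqsum (e 0 - X x)).
  exact: normc_coord_le.
rewrite ell2_addE ell2_oppE intertwiner_coord big_nat1 X00 mulr0 subr0 normc1.
apply/negP; rewrite -ltNge -ltcR.
by move: e0y; rewrite -xy -ball_normE.
Qed.

(** The diagonal entries of X are bounded by its norm, and they equal the
    ratios of the weight products times a nonzero constant. *)
Lemma intertwiner_dominated : dense (range X) -> weight_dominated l w.
Proof.
move=> /intertwiner_dense_corner X00; have [M M0 XM] := bounded_op_ge0 X_bounded.
have a0 := normc_gt0 X00.
exists ((normc M / normc (X (e 0) 0%N)) ^+ 2) => n.
rewrite !weight_hatE -exprMn ler_pXn2r ?nnegrE ?mulr_ge0 ?invr_ge0 ?normc_ge0'//;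
  do ?exact/ltW/weight_prod_gt0.
rewrite mulrAC ler_pdivlMr//.
have := congr1 (@normc R) (intertwiner_diag n).
rewrite !normcM !normc_real ?(ltW (weight_prod_gt0 _ _))// => <-.
rewrite mulrC ler_wpM2r ?(ltW (weight_prod_gt0 _ _))//.
apply: le_trans (normc_coord_le _ _) _; rewrite -lecR -ell2_sqsumE.
apply: le_trans (XM _) _; rewrite -[_%:C]/(`|M|) (ger0_norm M0).
by rewrite ler_piMr// norm_ell2_basis.
Qed.

End Matrix.
End Intertwiners.

(** * Sequences that multiply l^2 into l^2 *)

Section Multiplier.
Variables (R : realType) (t : nat -> R).

(** The running maximum of the squares t_k^2, started at 1. *)
Fixpoint sqr_record n : R :=
  if n is m.+1 then Num.max (sqr_record m) (t m ^+ 2) else 1.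

Lemma sqr_record_ge1 n : 1 <= sqr_record n.
Proof. by elim: n => //= n IH; rewrite le_max IH. Qed.

Lemma sqr_record_gt0 n : 0 < sqr_record n.
Proof. exact: lt_le_trans (sqr_record_ge1 n). Qed.

Lemma sqr_record_le n : sqr_record n <= sqr_record n.+1.
Proof. by rewrite /= le_max lexx. Qed.

(** The square of the multiplier that tests the growth of t: it sits on the
    indices where t sets a record, and it telescopes, so its sum is at most 1. *)
Definition record_mass n : R := (sqr_record n)^-1 - (sqr_record n.+1)^-1.

Lemma record_mass_ge0 n : 0 <= record_mass n.
Proof. by rewrite subr_ge0 lef_pV2 ?posrE ?sqr_record_gt0// sqr_record_le. Qed.

Lemma sum_record_mass_le N : \sum_(0 <= n < N) record_mass n <= 1.
Proof.
rewrite -(@opprK _ (\sum_(_ <= _ < _) _)) -sumrN.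
under eq_bigr do rewrite opprB.
by rewrite telescope_sumr// opprB /= invr1 gerBl invr_ge0 ltW// sqr_record_gt0.
Qed.

(** At a record n the maximum becomes t_n^2, and t_n^2 (1/S_n - 1/t_n^2) + 1 is
    exactly t_n^2 / S_n; elsewhere the maximum does not move. *)
Lemma sqr_record_step n :
  sqr_record n.+1 <= sqr_record n * (1 + t n ^+ 2 * record_mass n).
Proof.
have S0 := sqr_record_gt0 n; have m0 := record_mass_ge0 n.
have := erefl (sqr_record n.+1); rewrite [RHS]/= maxEle; case: ifPn => [St|_] E.
  have t0 : 0 < t n ^+ 2 by exact: lt_le_trans St.
  rewrite /record_mass E; move: (t n ^+ 2) t0 {St E} => q q0.
  rewrite le_eqVlt; apply/orP; left; apply/eqP; field.
  by rewrite !gt_eqF.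
by rewrite E ler_peMr ?(ltW S0)// lerDl mulr_ge0// sqr_ge0.
Qed.

(** Apply the hypothesis to the square root d of the record mass: by
    sqr_record_step and 1 + u <= exp u, the running maximum S_N is at most the
    exponential of the sum of the (t_n d_n)^2 over n < N, which is bounded. *)
Lemma ell2_multiplier_bounded :
  (forall d : nat -> R, (forall n, 0 <= d n) ->
     (exists B, forall N, \sum_(0 <= n < N) d n ^+ 2 <= B) ->
     exists B, forall N, \sum_(0 <= n < N) (t n * d n) ^+ 2 <= B) ->
  exists B, forall n, t n ^+ 2 <= B.
Proof.
move=> /(_ (fun n => Num.sqrt (record_mass n))) [|| B tB].
- by move=> n; exact: sqrtr_ge0.
- exists 1 => N; under eq_bigr do rewrite sqr_sqrtr ?record_mass_ge0//.
  exact: sum_record_mass_le.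
exists (expR B) => n.
have record_le N : sqr_record N <=
    expR (\sum_(0 <= n < N) t n ^+ 2 * record_mass n).
  elim: N => [|N IH]; first by rewrite big_geq// expR0.
  rewrite big_nat_recr//= expRD; apply: le_trans (sqr_record_step N) _.
  rewrite ler_pM ?(ltW (sqr_record_gt0 _)) ?expR_ge1Dx//.
  by rewrite addr_ge0// mulr_ge0 ?sqr_ge0 ?record_mass_ge0.
apply: (@le_trans _ _ (sqr_record n.+1)); first by rewrite /= le_max lexx orbT.
apply: le_trans (record_le _) _; rewrite ler_expR.
apply: le_trans (tB n.+1); rewrite le_eqVlt; apply/orP; left; apply/eqP.
by apply: eq_bigr => k _; rewrite exprMn sqr_sqrtr ?record_mass_ge0.
Qed.

End Multiplier.

(** * Lower triangular systems *)

Section TriangularSystem.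
(* The coefficient of the unknown x_k in the m-th equation is t k m, so that
   t k lists column k, as X (e k) does for an operator X. *)
Variables (R : realType) (t : nat -> nat -> R[i]) (d : nat -> R).
Hypotheses (t_neq0 : forall m, t m m != 0) (d_ge0 : forall m, 0 <= d m).

(** The choice of sign of r for which subtracting s does not shrink the
    modulus below r: the distances from s to r and to -r cannot both be below r. *)
Definition opposing_sign (r : R) (s : R[i]) : R[i] :=
  if r <= normc (r%:C - s) then r%:C else - r%:C.

Lemma normc_opposing_sign r s : 0 <= r -> normc (opposing_sign r s) = r.
Proof.
by move=> r0; rewrite /opposing_sign; case: ifP; rewrite ?normcN normc_real.
Qed.

Lemma opposing_signB r s : 0 <= r -> r <= normc (opposing_sign r s - s).
Proof.
move=> r0; rewrite /opposing_sign; case: ifPn => //; rewrite -ltNge => lt_r.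
have := le_normcD (r%:C - s) (- (- r%:C - s)).
rewrite normcN (_ : _ + - _ = (r + r)%:C); last by rewrite rmorphD/=; ring.
rewrite normc_real ?addr_ge0// => ?; lra.
Qed.

(** Strong recursion by prefixes: solution_prefix n is correct below n and is
    overwritten at index m = n - 1 only, where the m-th equation is solved for
    its diagonal unknown. *)
Fixpoint solution_prefix n : nat -> R[i] :=
  if n is m.+1 then
    let s := \sum_(0 <= j < m) solution_prefix m j * t j m in
    fun k => if k == m then (opposing_sign (d m) s - s) / t m m
             else solution_prefix m k
  else fun=> 0.

Definition solution k : R[i] := solution_prefix k.+1 k.

Lemma solution_prefixE n k : (k < n)%N -> solution_prefix n k = solution k.
Proof.
elim: n => // n IH; rewrite ltnS leq_eqVlt => /predU1P[->//|kn].
by rewrite /= (ltn_eqF kn) IH.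
Qed.

(** Forward substitution in a lower triangular system whose right-hand side is
    free up to sign: choosing each sign against the terms already fixed makes
    the diagonal term at least as large as the right-hand side. *)
Lemma triangular_solution : exists x : nat -> R[i], forall m,
  normc (\sum_(0 <= k < m.+1) x k * t k m) = d m /\ d m <= normc (x m * t m m).
Proof.
exists solution => m; set s := \sum_(0 <= k < m) solution k * t k m.
have xm : solution m * t m m = opposing_sign (d m) s - s.
  have sE : \sum_(0 <= k < m) solution_prefix m k * t k m = s.
    by apply: eq_big_nat => k /andP[_ km]; rewrite solution_prefixE.
  by rewrite /solution /= eqxx sE divfK.
by rewrite big_nat_recr//= -/s xm addrC subrK normc_opposing_sign// opposing_signB.
Qed.

End TriangularSystem.

(** * Diagonal operators *)

Section Diagonal.
Variable R : realType.
Local Notation ell2 := (ell2 R).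

Lemma diagonal_op_exists (c : nat -> R[i]) (M : R) : (forall n, normc (c n) <= M) ->
  exists D : {linear ell2 -> ell2},
    bounded_op D /\ forall x n, D x n = c n * x n.
Proof.
move=> cM; have M0 : 0 <= M by apply: le_trans (cM 0%N); exact: normc_ge0'.
have bnd (x : ell2) : square_summable (fun n => c n * x n : R[i]^o) /\
    sqsum (fun n => c n * x n : R[i]^o) <= M ^+ 2 * sqsum x.
  apply: square_summable_bound => N.
  apply: (@le_trans _ _ (M ^+ 2 * sqsum_upto x N)); last first.
    by rewrite ler_wpM2l ?sqr_ge0//; apply: sqsum_upto_le; exact: ell2_summable.
  rewrite /sqsum_upto mulr_sumr; apply: ler_sum => n _.
  by rewrite normcM exprMn ler_wpM2r ?sqr_ge0// ler_pXn2r ?nnegrE ?normc_ge0'.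
have sP (x : ell2) : (fun n => c n * x n : R[i]^o) \in square_summable_pred.
  by rewrite inE; exact: (proj1 (bnd x)).
pose D (x : ell2) : ell2 := Ell2 (sP x).
have linD : linear D.
  move=> a x y; apply: ell2_ext => n.
  change (c n * (a * x n + y n) = a * (c n * x n) + c n * y n :> R[i]).
  by ring.
pose DL : {linear ell2 -> ell2} :=
  HB.pack D (GRing.isLinear.Build _ _ _ _ _ linD).
exists DL; split=> //; exists M%:C => x; rewrite !ell2_sqsumE -rmorphM/= lecR.
rewrite -{1}(ger0_norm M0) -sqrtr_sqr -sqrtrM ?sqr_ge0//.
by apply: ler_wsqrtr; exact: (proj2 (bnd x)).
Qed.

End Diagonal.

(** * Similarity and domination of weights *)

Section Domination.
Variable R : realType.
Local Notation ell2 := (ell2 R).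
Local Notation e := (ell2_basis R).

Section Pair.
Variables (l w : nat -> R) (Wl Ww : {linear ell2 -> ell2}).
Hypotheses (l_gt0 : forall n, 0 < l n) (w_gt0 : forall n, 0 < w n).
Hypotheses (Wl_shift : weighted_shift l Wl) (Ww_shift : weighted_shift w Ww).

(** A hands-on substitute for the bounded inverse theorem.  Given d in l^2, let
    x solve the triangular system of X with right-hand side y of moduli d, so
    that d_m <= |x_m| |X_mm|.  Then y is in l^2, hence y = X x' with x' in l^2,
    and x' = x because a triangular system has one solution.  Thus d_m / |X_mm|
    is square summable for all d in l^2, so 1 / |X_mm| is bounded; and X_mm is
    the ratio of the weight products up to a nonzero constant. *)
Lemma surjective_intertwiner_dominated (X : {linear ell2 -> ell2}) :
  bounded_op X -> X \o Wl = Ww \o X -> range X = setT ->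
  weight_dominated w l.
Proof.
move=> XM XWl Xsurj.
have X00 : X (e 0) 0%N != 0.
  apply: (intertwiner_dense_corner l_gt0 Wl_shift Ww_shift XM XWl).
  by rewrite Xsurj => O [y Oy] _; exists y.
pose t k m : R[i] := X (e k) m.
have diagE := intertwiner_diag Wl_shift Ww_shift XWl.
have prod_neq0 (v : nat -> R) n :
    (forall n, 0 < v n) -> (weight_prod v n)%:C != 0 :> R[i].
  by move=> v0; rewrite fmorph_eq0 gt_eqF// weight_prod_gt0.
have t_neq0 m : t m m != 0.
  have : (weight_prod w m)%:C * X (e 0) 0%N != 0 :> R[i].
    by rewrite mulf_neq0 ?prod_neq0.
  by apply: contra => /eqP tmm; rewrite -diagE -[X _ _]/(t m m) tmm mulr0.
have nt_gt0 m := normc_gt0 (t_neq0 m).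
have [B tB] : exists B, forall n, (normc (t n n))^-1 ^+ 2 <= B.
  apply: ell2_multiplier_bounded => d d0 [B dB].
  have [x xP] := triangular_solution t_neq0 d0.
  pose y m : R[i]^o := \sum_(0 <= k < m.+1) x k * t k m.
  have [ysum _] : square_summable y /\ sqsum y <= B.
    apply: square_summable_bound => N; apply: le_trans (dB N).
    by apply: ler_sum => m _; rewrite (proj1 (xP m)).
  have yP : y \in square_summable_pred by rewrite inE.
  have [x' _ x'y] : range X (Ell2 yP) by rewrite Xsurj.
  (* Both x and x' solve the triangular system with right-hand side y. *)
  have x'E m : x' m = x m.
    elim/ltn_ind: m => m IH; apply: (mulIf (t_neq0 m)).
    have : X x' m = y m by rewrite x'y.
    rewrite (intertwiner_coord l_gt0 Wl_shift Ww_shift XM XWl) /y.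
    rewrite !big_nat_recr//= (eq_big_nat _ _ (F2 := fun k => x k * t k m)).
      by move=> /addrI.
    by move=> k /andP[_ km]; rewrite IH.
  exists (sqsum x') => N.
  apply: (@le_trans _ _ (sqsum_upto x' N)); last first.
    by apply: sqsum_upto_le; exact: ell2_summable.
  apply: ler_sum => m _; rewrite x'E mulrC.
  rewrite ler_pXn2r ?nnegrE ?normc_ge0' ?mulr_ge0 ?invr_ge0 ?normc_ge0'//.
  by rewrite ler_pdivrMr// -normcM (proj2 (xP m)).
exists (B * normc (X (e 0) 0%N) ^+ 2) => n.
have E : weight_prod l n * normc (t n n) = weight_prod w n * normc (X (e 0) 0%N).
  have := congr1 (@normc R) (diagE n).
  by rewrite !normcM !normc_real// ltW// weight_prod_gt0.
rewrite !weight_hatE -mulrA -exprMn [_ * weight_prod w n]mulrC -E exprMn.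
rewrite mulrCA ler_peMr ?sqr_ge0//.
by rewrite -ler_pdivrMr ?exprn_gt0// mul1r -exprVn.
Qed.

Lemma dominated_ratio_bounded : weight_dominated l w ->
  exists M, forall n, normc (weight_prod w n / weight_prod l n)%:C <= M.
Proof.
move=> [C lwC]; exists (Num.sqrt C) => n.
have l0 := weight_prod_gt0 n l_gt0; have w0 := weight_prod_gt0 n w_gt0.
have q0 : 0 <= weight_prod w n / weight_prod l n by rewrite divr_ge0 ?ltW.
rewrite normc_real// -(ger0_norm q0) -sqrtr_sqr ler_wsqrtr//.
by rewrite exprMn exprVn ler_pdivrMr ?exprn_gt0// -!weight_hatE.
Qed.
End Pair.

(** The diagonal operator with entries the ratios of the weight products
    intertwines the shifts; the two dominations bound it and its inverse. *)
Lemma dominated_similar (l w : nat -> R) (Wl Ww : {linear ell2 -> ell2}) :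
  (forall n, 0 < l n) -> (forall n, 0 < w n) ->
  weighted_shift l Wl -> weighted_shift w Ww ->
  weight_dominated l w -> weight_dominated w l -> similar_op Wl Ww.
Proof.
move=> l_gt0 w_gt0 Wl_shift Ww_shift lw wl.
have [M cM] := dominated_ratio_bounded l_gt0 w_gt0 lw.
have [N cN] := dominated_ratio_bounded w_gt0 l_gt0 wl.
have [X [XM XE]] := diagonal_op_exists cM.
have [Y [_ YE]] := diagonal_op_exists cN.
have p0 (v : nat -> R) n : (forall n, 0 < v n) -> weight_prod v n != 0.
  by move=> v0; rewrite gt_eqF// weight_prod_gt0.
exists X; split=> //.
  exists Y => x; apply: ell2_ext => n;
  rewrite ?(XE, YE) mulrA -rmorphM/= mulf_div;
  by rewrite [_ * weight_prod w n]mulrC divff ?mul1r// mulf_neq0 ?p0.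
apply/funext => x; apply: ell2_ext => -[|n] /=; rewrite XE.
  by rewrite (weighted_shift0 _ Wl_shift) (weighted_shift0 _ Ww_shift) mulr0.
rewrite (weighted_shiftS _ _ Wl_shift) (weighted_shiftS _ _ Ww_shift) XE !mulrA.
rewrite -!rmorphM/=; congr (_%:C * _); rewrite !weight_prodS.
by field; rewrite p0//= gt_eqF.
Qed.

Lemma similar_quasi_affine (Wl Ww : {linear ell2 -> ell2}) :
  similar_op Wl Ww -> quasi_affine_transform Wl Ww.
Proof.
move=> [X [XM Xbij XW]]; exists X; split=> //; split; first exact: bij_inj.
have [Y _ XK] := Xbij.
by move=> O [y Oy] _; exists y; split=> //; exists (Y y).
Qed.

Lemma ereal_inf_ratio_gt0 (l w : nat -> R) :
  (forall n, 0 < l n) -> (forall n, 0 < w n) ->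
  (0 < ereal_inf (range (fun n => (weight_hat w n / weight_hat l n)%:E)))%E <->
  weight_dominated w l.
Proof.
move=> l_gt0 w_gt0.
have h0 (v : nat -> R) n : (forall n, 0 < v n) -> 0 < weight_hat v n.
  by move=> v0; rewrite weight_hatE exprn_gt0// weight_prod_gt0.
set A := (X in ereal_inf X); split=> [infA|[C wlC]].
  have infle n : (ereal_inf A <= (weight_hat w n / weight_hat l n)%:E)%E.
    by apply: ereal_inf_lbound; exists n.
  have inffin : ereal_inf A \is a fin_num.
    by rewrite fin_real// (lt_trans _ infA)//= (le_lt_trans (infle 0%N)) ?ltry.
  exists (fine (ereal_inf A))^-1 => n; have := infle n.
  rewrite -(fineK inffin) lee_fin ler_pdivlMr ?h0// => ?.
  have i0 : 0 < fine (ereal_inf A) by rewrite fine_gt0// infA ltey_eq inffin.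
  by rewrite mulrC ler_pdivlMr// mulrC.
have C0 : 0 < C.
  by have := lt_le_trans (h0 _ 0%N l_gt0) (wlC 0%N); rewrite pmulr_lgt0 ?h0.
apply: (@lt_le_trans _ _ (C^-1)%:E); first by rewrite lte_fin invr_gt0.
apply: le_ereal_inf_tmp => _ [n _ <-].
by rewrite lee_fin ler_pdivlMr ?h0// mulrC ler_pdivrMr// mulrC.
Qed.

Lemma ereal_sup_ratio_lty (l w : nat -> R) :
  (forall n, 0 < l n) -> (forall n, 0 < w n) ->
  (ereal_sup (range (fun n => (weight_hat w n / weight_hat l n)%:E)) < +oo)%E <->
  weight_dominated l w.
Proof.
move=> l_gt0 w_gt0.
have h0 (v : nat -> R) n : (forall n, 0 < v n) -> 0 < weight_hat v n.
  by move=> v0; rewrite weight_hatE exprn_gt0// weight_prod_gt0.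
set A := (X in ereal_sup X); split=> [supA|[C lwC]].
  have supge n : ((weight_hat w n / weight_hat l n)%:E <= ereal_sup A)%E.
    by apply: ereal_sup_ubound; exists n.
  have supfin : ereal_sup A \is a fin_num.
    by rewrite fin_real// supA andbT (lt_le_trans _ (supge 0%N)) ?ltNyr.
  exists (fine (ereal_sup A)) => n; have := supge n.
  by rewrite -{1}(fineK supfin) lee_fin ler_pdivrMr ?h0.
apply: (@le_lt_trans _ _ C%:E); last exact: ltry.
apply: ge_ereal_sup => _ [n _ <-].
by rewrite lee_fin ler_pdivrMr ?h0.
Qed.

End Domination.

(** * Equivalence of the four conditions *)

Theorem theoremA2 (R : realType) (l w : nat -> R)
    (l_gt0 : forall n, 0 < l n) (l_bounded : bounded_fun l)
    (w_gt0 : forall n, 0 < w n) (w_bounded : bounded_fun w)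
    (Wl Ww : {linear ell2 R -> ell2 R})
    (Wl_shift : weighted_shift l Wl) (Ww_shift : weighted_shift w Ww) :
  [<-> exists X Y : {linear ell2 R -> ell2 R},
         [/\ bounded_op X, dense (range X) & X \o Wl = Ww \o X] /\
         [/\ bounded_op Y, dense (range Y) & Y \o Ww = Wl \o Y];
       quasi_similar Wl Ww;
       similar_op Wl Ww;
       (0 < ereal_inf (range (fun n => (weight_hat w n / weight_hat l n)%:E)))%E /\
       (ereal_sup (range (fun n => (weight_hat w n / weight_hat l n)%:E)) < +oo)%E].
Proof.
have quasi_dense : quasi_similar Wl Ww ->
    exists X Y : {linear ell2 R -> ell2 R},
      [/\ bounded_op X, dense (range X) & X \o Wl = Ww \o X] /\
      [/\ bounded_op Y, dense (range Y) & Y \o Ww = Wl \o Y].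
  by move=> [[X [XM [_ Xd] XW]] [Y [YM [_ Yd] YW]]]; exists X, Y.
have dominated_quasi : weight_dominated l w -> weight_dominated w l ->
    quasi_similar Wl Ww.
  move=> lw wl; split; apply: similar_quasi_affine.
    exact: (dominated_similar l_gt0 w_gt0 Wl_shift Ww_shift).
  exact: (dominated_similar w_gt0 l_gt0 Ww_shift Wl_shift).
have dense_dominated : (exists X Y : {linear ell2 R -> ell2 R},
      [/\ bounded_op X, dense (range X) & X \o Wl = Ww \o X] /\
      [/\ bounded_op Y, dense (range Y) & Y \o Ww = Wl \o Y]) ->
    weight_dominated l w /\ weight_dominated w l.
  move=> [X [Y [[XM Xd XW] [YM Yd YW]]]]; split.
    exact: (intertwiner_dominated l_gt0 w_gt0 Wl_shift Ww_shift XM XW).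
  exact: (intertwiner_dominated w_gt0 l_gt0 Ww_shift Wl_shift YM YW).
have infP := ereal_inf_ratio_gt0 l_gt0 w_gt0.
have supP := ereal_sup_ratio_lty l_gt0 w_gt0.
tfae.
- by move=> /dense_dominated[lw wl]; exact: dominated_quasi.
- move=> /quasi_dense/dense_dominated[lw wl].
  exact: (dominated_similar l_gt0 w_gt0 Wl_shift Ww_shift).
- move=> sim; have [X [XM [Y _ XK] XW]] := sim.
  have Xsurj : range X = setT.
    by apply/seteqP; split=> // y _; exists (Y y).
  split.
    apply/infP.
    exact: (surjective_intertwiner_dominated l_gt0 w_gt0 Wl_shift Ww_shift XM XW).
  apply/supP; have [X' [XM' [_ Xd] XW']] := similar_quasi_affine sim.
  exact: (intertwiner_dominated l_gt0 w_gt0 Wl_shift Ww_shift XM' XW').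
- by move=> [/infP wl /supP lw]; apply: quasi_dense; exact: dominated_quasi.
Qed.
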